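(* Let $k\in 3{\rm \mathbb{Z}}$ be nonzero. Then every locally soluble ${\rm SL}_2({\rm \mathbb{Q}})$-orbit on $V({\rm \mathbb{Q}})_{4k}$ contains an element of $V({\rm \mathbb{Z}})_{4k}$.
   Context: For a ring $R$, $V(R)$ is the set of binary cubic forms $f=[a,3b,3c,d]=au^3+3bu^2v+3cuv^2+dv^3$, $a,b,c,d\in R$, with ${\rm SL}_2(R)$ acting by linear change of variables; ${\rm disc}(f)=a^2d^2-6abcd+4ac^3+4b^3d-3b^2c^2$ and $V(R)_{4k}=\{f:{\rm disc}(f)=4k\}$. A form $f\in V({\rm \mathbb{Q}})$ is locally soluble if for every place $v$ of ${\rm \mathbb{Q}}$ the equation $z^3=f(u,v)$ has a nonzero solution over ${\rm \mathbb{Q}}_v$; an orbit is locally soluble if its elements are. *)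

(* Defs.v *)
From HB Require Import structures.
From mathcomp Require Import all_boot all_order all_algebra.
From mathcomp Require Import generic_quotient ring_quotient.
From mathcomp Require Import boolp classical_sets functions reals.
From mathcomp Require Import ring lra.

Set Implicit Arguments.
Unset Strict Implicit.
Unset Printing Implicit Defensive.

Import Order.TTheory GRing.Theory Num.Theory.

Local Open Scope ring_scope.

(** [Qp p_pr], for [p_pr : prime p], is the completion of [rat] for the p-adic
    absolute value: the ring of p-adic Cauchy sequences of rationals modulo the
    ideal of p-adic null sequences. *)

Definition padic_val (p : nat) (x : rat) : int :=
  (logn p `|numq x|)%:Z - (logn p `|denq x|)%:Z.

Definition padic_norm (p : nat) (x : rat) : rat :=
  if x == 0 then 0 else p%:R ^ (- padic_val p x).

Definition padic_cauchy (p : nat) (x : nat -> rat) : Prop :=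
  forall e : rat, 0 < e -> exists N : nat, forall m n : nat,
    (N <= m)%N -> (N <= n)%N -> padic_norm p (x m - x n) < e.

Definition padic_null (p : nat) (x : nat -> rat) : Prop :=
  forall e : rat, 0 < e -> exists N : nat, forall n : nat,
    (N <= n)%N -> padic_norm p (x n) < e.

Section PadicNorm.
Variables (p : nat) (p_pr : prime p).
Local Notation norm := (padic_norm p).

Lemma padic_norm0 : norm 0 = 0.
Proof. by rewrite /padic_norm eqxx. Qed.

Lemma padic_norm_gt0 x : x != 0 -> 0 < norm x.
Proof.
by move=> /negPf x0; rewrite /padic_norm x0 exprz_gt0// ltr0n prime_gt0.
Qed.

Lemma padic_norm_ge0 x : 0 <= norm x.
Proof.
by have [->|/padic_norm_gt0/ltW//] := eqVneq x 0; rewrite padic_norm0.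
Qed.

Lemma padic_norm_eq0 x : (norm x == 0) = (x == 0).
Proof.
have [->|x0] := eqVneq x 0; first by rewrite padic_norm0 eqxx.
by rewrite gt_eqF// padic_norm_gt0.
Qed.

Lemma padic_val_frac (a b : int) : a != 0 -> b != 0 ->
  padic_val p (a%:~R / b%:~R) = (logn p `|a|)%:Z - (logn p `|b|)%:Z.
Proof.
move=> a0 b0; set x : rat := _ / _.
have bQ0 : (b%:~R : rat) != 0 by rewrite intr_eq0.
have x0 : x != 0 by rewrite /x mulf_neq0 ?invr_eq0 ?intr_eq0.
have n0 : numq x != 0 by rewrite numq_eq0.
have d0 : denq x != 0 by rewrite denq_eq0.
have dQ0 : ((denq x)%:~R : rat) != 0 by rewrite intr_eq0.
have E : numq x * b = a * denq x.
  apply: (@intr_inj rat); rewrite !intrM.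
  have := divq_num_den x; rewrite {3}/x => /eqP; rewrite eqr_div// => /eqP ->.
  by [].
have := congr1 (fun z : int => logn p `|z|) E.
rewrite /= !abszM !lognM ?absz_gt0// /padic_val => H.
apply/eqP; rewrite subr_eq addrAC eq_sym subr_eq -!PoszD eqz_nat.
by rewrite -H addnC.
Qed.

Lemma padic_valM x y : x != 0 -> y != 0 ->
  padic_val p (x * y) = padic_val p x + padic_val p y.
Proof.
move=> x0 y0; rewrite -{1}(divq_num_den x) -{1}(divq_num_den y).
rewrite mulf_div -!intrM padic_val_frac ?mulf_neq0 ?numq_eq0 ?denq_eq0//.
rewrite !abszM !lognM ?absz_gt0 ?numq_eq0 ?denq_eq0// /padic_val !PoszD; ring.
Qed.

Lemma padic_normM x y : norm (x * y) = norm x * norm y.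
Proof.
have [->|x0] := eqVneq x 0; first by rewrite mul0r padic_norm0 mul0r.
have [->|y0] := eqVneq y 0; first by rewrite mulr0 padic_norm0 mulr0.
rewrite /padic_norm mulf_eq0 (negPf x0) (negPf y0)/= padic_valM// opprD.
by rewrite expfzDr// pnatr_eq0 -lt0n prime_gt0.
Qed.

Lemma padic_norm1 : norm 1 = 1.
Proof.
by rewrite /padic_norm oner_eq0 /padic_val (numq_int 1) (denq_int 1) subrr oppr0.
Qed.

Lemma padic_normN x : norm (- x) = norm x.
Proof. by rewrite /padic_norm oppr_eq0 /padic_val numqN denqN abszN. Qed.

Lemma padic_normB x y : norm (x - y) = norm (y - x).
Proof. by rewrite -padic_normN opprB. Qed.

Lemma padic_normV x : norm x^-1 = (norm x)^-1.
Proof.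
have [->|x0] := eqVneq x 0; first by rewrite !(invr0, padic_norm0).
apply: (mulfI (x := norm x)); first by rewrite padic_norm_eq0.
by rewrite -padic_normM !mulfV ?padic_norm1// padic_norm_eq0.
Qed.

Lemma padic_norm_int (a : int) : a != 0 -> norm a%:~R = p%:R ^- logn p `|a|.
Proof.
move=> a0; rewrite /padic_norm intr_eq0 (negPf a0) /padic_val numq_int denq_int.
by rewrite logn1 subr0 exprnN.
Qed.

Lemma padic_normD_int (a b : int) :
  norm (a + b)%:~R <= Num.max (norm a%:~R) (norm b%:~R).
Proof.
have [->|a0] := eqVneq a 0; first by rewrite add0r le_max lexx orbT.
have [->|b0] := eqVneq b 0; first by rewrite addr0 le_max lexx.
have [->|c0] := eqVneq (a + b) 0.
  by rewrite padic_norm0 le_max padic_norm_ge0.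
have p1 : (1 : rat) < p%:R by rewrite ltr1n prime_gt1.
have p0 : (0 : rat) < p%:R by rewrite ltr0n prime_gt0.
have key : (minn (logn p `|a|) (logn p `|b|) <= logn p `|(a + b)%R|)%N.
  rewrite -pfactor_dvdn ?absz_gt0//.
  set e := minn _ _.
  have dv (c : int) : c != 0 -> (e <= logn p `|c|)%N ->
      ((p ^ e)%:Z %| c)%Z by move=> ? ?; rewrite dvdzE/= pfactor_dvdn ?absz_gt0.
  have : ((p ^ e)%:Z %| a + b)%Z.
    by rewrite rpredD// dv// ?geq_minl ?geq_minr.
  by rewrite dvdzE.
have mono (i j : nat) : (i <= j)%N -> (p%:R : rat) ^- j <= p%:R ^- i.
  by move=> ij; rewrite lef_pV2 ?posrE ?exprn_gt0// ler_eXn2l.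
rewrite !padic_norm_int// le_max.
move: key; rewrite geq_min => /orP[] k; first by rewrite mono.
by rewrite (mono _ _ k) orbT.
Qed.

Lemma padic_normD x y : norm (x + y) <= Num.max (norm x) (norm y).
Proof.
set d := denq x * denq y.
have d0 : d != 0 by rewrite mulf_neq0 ?denq_eq0.
have dQ0 : (d%:~R : rat) != 0 by rewrite intr_eq0.
have nd0 : 0 < norm d%:~R by rewrite padic_norm_gt0.
have dx : x * d%:~R = (numq x * denq y)%:~R.
  by rewrite /d !intrM mulrA -numqE.
have dy : y * d%:~R = (numq y * denq x)%:~R.
  by rewrite /d mulrC !intrM mulrC [_%:~R * _]mulrC mulrA -numqE.
rewrite -(ler_pM2r nd0) maxr_pMl ?(ltW nd0)// -!padic_normM mulrDl dx dy -intrD.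
exact: padic_normD_int.
Qed.

Lemma padic_normD_lt x y e : norm x < e -> norm y < e -> norm (x + y) < e.
Proof.
by move=> xe ye; rewrite (le_lt_trans (padic_normD x y))// gt_max xe ye.
Qed.

Lemma padic_cauchy_bounded x : padic_cauchy p x ->
  exists2 C, 0 < C & exists N, forall n, (N <= n)%N -> norm (x n) < C.
Proof.
move=> /(_ 1 ltr01)[N HN]; exists (norm (x N) + 1).
  by rewrite ltr_wpDl ?padic_norm_ge0.
exists N => n Nn; rewrite -(subrK (x N) (x n)); apply: padic_normD_lt.
  by rewrite (lt_le_trans (HN _ _ Nn (leqnn _)))// lerDr padic_norm_ge0.
by rewrite ltrDl.
Qed.

Lemma padic_cauchyB x y :
  padic_cauchy p x -> padic_cauchy p y -> padic_cauchy p (x - y).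
Proof.
move=> cx cy e e0; have [N HN] := cx e e0; have [M HM] := cy e e0.
exists (maxn N M) => m n; rewrite !geq_max => /andP[Nm Mm] /andP[Nn Mn].
rewrite [X in norm X](_ : _ = (x m - x n) + (y n - y m)).
  by apply: padic_normD_lt; [exact: HN|exact: HM].
by have E i : (x - y) i = x i - y i by []; rewrite !E; ring.
Qed.

Lemma padic_cauchyM x y :
  padic_cauchy p x -> padic_cauchy p y -> padic_cauchy p (x * y).
Proof.
move=> cx cy e e0.
have [C C0 [K HK]] := padic_cauchy_bounded cx.
have [D D0 [L HL]] := padic_cauchy_bounded cy.
have [N HN] := cx (e / D) (divr_gt0 e0 D0).
have [M HM] := cy (e / C) (divr_gt0 e0 C0).
exists (maxn (maxn K L) (maxn N M)) => m n; rewrite !geq_max.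
move=> /andP[/andP[Km Lm] /andP[Nm Mm]] /andP[/andP[Kn Ln] /andP[Nn Mn]].
rewrite [X in norm X](_ : _ = (x m - x n) * y m + (y m - y n) * x n); last first.
  by have E i : (x * y) i = x i * y i by []; rewrite !E; ring.
apply: padic_normD_lt; rewrite padic_normM.
  rewrite -[e](divfK (lt0r_neq0 D0)).
  by rewrite ltr_pM ?padic_norm_ge0// ?HN ?HL.
rewrite -[e](divfK (lt0r_neq0 C0)).
by rewrite ltr_pM ?padic_norm_ge0// ?HM ?HK.
Qed.

Lemma padic_cauchy_cst c : padic_cauchy p (fun=> c).
Proof. by move=> e e0; exists 0%N => m n _ _; rewrite subrr padic_norm0. Qed.

Lemma padic_nullB x y :
  padic_null p x -> padic_null p y -> padic_null p (x - y).
Proof.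
move=> cx cy e e0; have [N HN] := cx e e0; have [M HM] := cy e e0.
exists (maxn N M) => n; rewrite !geq_max => /andP[Nn Mn].
apply: padic_normD_lt; first exact: HN.
by rewrite padic_normN; exact: HM.
Qed.

Lemma padic_nullM x y :
  padic_cauchy p x -> padic_null p y -> padic_null p (x * y).
Proof.
move=> cx cy e e0.
have [C C0 [K HK]] := padic_cauchy_bounded cx.
have [M HM] := cy (e / C) (divr_gt0 e0 C0).
exists (maxn K M) => n; rewrite !geq_max => /andP[Kn Mn].
rewrite [X in norm X](_ : _ = x n * y n)// padic_normM mulrC.
rewrite -[e](divfK (lt0r_neq0 C0)).
by rewrite ltr_pM ?padic_norm_ge0// ?HM ?HK.
Qed.

Lemma padic_null_cst c : padic_null p (fun=> c) -> c = 0.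
Proof.
move=> nc; apply/eqP; apply: contraT => c0.
have [N /(_ N (leqnn N))] := nc _ (padic_norm_gt0 c0).
by rewrite ltxx.
Qed.

Lemma padic_cauchy_away x : padic_cauchy p x -> ~ padic_null p x ->
  exists2 c, 0 < c & exists N, forall n, (N <= n)%N -> c <= norm (x n).
Proof.
move=> cx nx.
have [e e0 He] : exists2 e, 0 < e &
    forall N, exists2 n, (N <= n)%N & e <= norm (x n).
  apply: contrapT => H; apply: nx => e e0; apply: contrapT => H'.
  apply: H; exists e => // N; apply: contrapT => H''.
  apply: H'; exists N => n Nn; rewrite ltNge; apply/negP => h.
  by apply: H''; exists n.
have [N HN] := cx e e0; have [m Nm em] := He N.
exists e => //; exists N => n Nn; rewrite leNgt; apply/negP => h.
move: em; rewrite leNgt => /negP; apply.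
by rewrite -(subrK (x n) (x m)); apply: padic_normD_lt => //; exact: HN.
Qed.

Lemma padic_cauchyV x : padic_cauchy p x -> ~ padic_null p x ->
  padic_cauchy p (fun n => (x n)^-1).
Proof.
move=> cx nx e e0; have [c c0 [N HN]] := padic_cauchy_away cx nx.
have [M HM] := cx (e * (c * c)) (mulr_gt0 e0 (mulr_gt0 c0 c0)).
exists (maxn N M) => m n; rewrite !geq_max => /andP[Nm Mm] /andP[Nn Mn].
have cm := HN _ Nm; have cn := HN _ Nn.
have xm0 : x m != 0 by rewrite -padic_norm_eq0 gt_eqF// (lt_le_trans c0).
have xn0 : x n != 0 by rewrite -padic_norm_eq0 gt_eqF// (lt_le_trans c0).
rewrite [X in norm X](_ : _ = (x n - x m) / (x m * x n)); last first.
  by field; rewrite xm0 xn0.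
rewrite padic_normM padic_normV padic_normM ltr_pdivrMr; last first.
  by rewrite mulr_gt0// padic_norm_gt0.
apply: (lt_le_trans (HM _ _ Mn Mm)).
by rewrite ler_pM2l// ler_pM// ltW.
Qed.

End PadicNorm.

Section Qp.
Variables (p : nat) (p_pr : prime p).

(* [p_pr] is an argument only so that the closure instances can be inferred. *)
Definition cauchy_pred of prime p : {pred nat -> rat} :=
  fun x => `[< padic_cauchy p x >].

Fact cauchy_subring : subring_closed (cauchy_pred p_pr).
Proof.
split=> [|x y /asboolP cx /asboolP cy|x y /asboolP cx /asboolP cy].
- by apply/asboolP; exact: padic_cauchy_cst.
- by apply/asboolP; exact: padic_cauchyB.
- by apply/asboolP; exact: padic_cauchyM.
Qed.
HB.instance Definition _ :=
  GRing.isSubringClosed.Build _ (cauchy_pred p_pr) cauchy_subring.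

Definition cauchy_seq : Type := {x : nat -> rat | x \in cauchy_pred p_pr}.
HB.instance Definition _ := [isSub of cauchy_seq for @sval _ _].
HB.instance Definition _ := [Choice of cauchy_seq by <:].
HB.instance Definition _ := [SubChoice_isSubComNzRing of cauchy_seq by <:].

Definition mk_cauchy_seq (x : nat -> rat) (cx : padic_cauchy p x) : cauchy_seq :=
  exist (fun x => x \in cauchy_pred p_pr) x (asboolT cx).

Lemma cauchy_seqP (x : cauchy_seq) : padic_cauchy p (val x).
Proof. exact/asboolP/(valP x). Qed.

Definition null_pred : {pred cauchy_seq} :=
  fun x => `[< padic_null p (val x) >].

Fact null_idealr : idealr_closed null_pred.
Proof.
split.
- apply/asboolP => e e0; exists 0%N => n _.
  by rewrite raddf0 [X in padic_norm _ X](_ : _ = 0)// padic_norm0.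
- apply/negP => /asboolP; rewrite rmorph1 => /(@padic_null_cst _ p_pr _)/eqP.
  by rewrite oner_eq0.
- move=> a x y /asboolP nx /asboolP ny; apply/asboolP.
  have -> : val (a * x + y) = val a * val x - (- val y).
    by rewrite opprK rmorphD rmorphM.
  apply: padic_nullB => //.
    by apply: padic_nullM => //; exact: cauchy_seqP.
  move=> e /ny[N HN]; exists N => n /HN.
  by have -> : (- val y) n = - val y n by []; rewrite padic_normN.
Qed.
HB.instance Definition _ := isIdealr.Build _ null_pred null_idealr.

Definition Qp : Type := {ideal_quot null_pred}.
HB.instance Definition _ := GRing.ComNzRing.on Qp.
HB.instance Definition _ := EqQuotient.on Qp.


Definition to_Qp (x : cauchy_seq) : Qp := \pi_({ideal_quot null_pred})%qT x.

Lemma to_Qp_surj (x : Qp) : exists y : cauchy_seq, to_Qp y = x.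
Proof. by exists (repr x); rewrite /to_Qp reprK. Qed.

Fact to_Qp_zmod : zmod_morphism to_Qp.
Proof. by move=> x y; rewrite /to_Qp !piE. Qed.
Fact to_Qp_monoid : monoid_morphism to_Qp.
Proof. by split=> [|x y]; rewrite /to_Qp !piE. Qed.
HB.instance Definition _ :=
  GRing.isZmodMorphism.Build cauchy_seq Qp to_Qp to_Qp_zmod.
HB.instance Definition _ :=
  GRing.isMonoidMorphism.Build cauchy_seq Qp to_Qp to_Qp_monoid.

Lemma to_Qp_eq0 (x : cauchy_seq) : to_Qp x = 0 <-> padic_null p (val x).
Proof.
rewrite -(rmorph0 to_Qp) /to_Qp.
have := Quotient.idealrBE null_pred x 0; rewrite subr0 => H.
by split=> [/eqP|h]; [rewrite -H => /asboolP|apply/eqP; rewrite -H; apply/asboolP].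
Qed.

Fact Qp_inv_ex (x : Qp) : exists y : Qp, x != 0 -> y * x = 1.
Proof.
have [->|] := eqVneq x 0; first by exists 0.
have [{}x <-] := to_Qp_surj x => x0.
have nx : ~ padic_null p (val x) by move=> /to_Qp_eq0/eqP; exact/negP.
have cV := padic_cauchyV p_pr (cauchy_seqP x) nx.
pose y : cauchy_seq := mk_cauchy_seq cV.
exists (to_Qp y) => _; apply/eqP; rewrite -subr_eq0 -rmorphM -(rmorph1 to_Qp).
rewrite -rmorphB; apply/eqP/to_Qp_eq0.
have [c c0 [N HN]] := padic_cauchy_away p_pr (cauchy_seqP x) nx.
move=> e e0; exists N => n Nn.
rewrite rmorphB rmorphM rmorph1 [X in padic_norm _ X](_ : _ = 0) ?padic_norm0//.
rewrite [LHS](_ : _ = (val x n)^-1 * val x n - 1)// mulVf ?subrr//.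
by rewrite -(padic_norm_eq0 p_pr) gt_eqF// (lt_le_trans c0)// HN.
Qed.

Definition Qp_inv (x : Qp) : Qp :=
  if x == 0 then 0 else xget 0 [set y : Qp | y * x = 1].

Fact Qp_mulVf (x : Qp) : x != 0 -> Qp_inv x * x = 1.
Proof.
move=> x0; rewrite /Qp_inv (negPf x0); have [y /(_ x0) yx] := Qp_inv_ex x.
by case: xgetP => [z _ //|/(_ y)].
Qed.

Fact Qp_inv0 : Qp_inv 0 = 0.
Proof. by rewrite /Qp_inv eqxx. Qed.

HB.instance Definition _ :=
  GRing.ComNzRing_isField.Build Qp Qp_mulVf Qp_inv0.

Definition cauchy_cst (c : rat) : cauchy_seq :=
  mk_cauchy_seq (padic_cauchy_cst p c).

Fact cauchy_cst_zmod : zmod_morphism cauchy_cst.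
Proof. by move=> a b; apply: val_inj. Qed.
Fact cauchy_cst_monoid : monoid_morphism cauchy_cst.
Proof. by split=> [|a b]; apply: val_inj. Qed.
HB.instance Definition _ :=
  GRing.isZmodMorphism.Build rat cauchy_seq cauchy_cst cauchy_cst_zmod.
HB.instance Definition _ :=
  GRing.isMonoidMorphism.Build rat cauchy_seq cauchy_cst cauchy_cst_monoid.

Lemma ratr_Qp (c : rat) : ratr c = to_Qp (cauchy_cst c) :> Qp.
Proof. by rewrite -(fmorph_eq_rat (to_Qp \o cauchy_cst)). Qed.

End Qp.

(** [Cubic a b c d] is the form
    [a u^3 + 3b u^2 v + 3c u v^2 + d v^3]. *)
Record cubic (R : Type) := Cubic { cubA : R; cubB : R; cubC : R; cubD : R }.

Definition cubic_map (R S : Type) (h : R -> S) (f : cubic R) : cubic S :=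
  Cubic (h (cubA f)) (h (cubB f)) (h (cubC f)) (h (cubD f)).

Section Cubic.
Variable R : comNzRingType.
Implicit Types (f : cubic R) (g : 'M[R]_2).

Definition cubic_eval f (u v : R) : R :=
  let: Cubic a b c d := f in
  a * u ^+ 3 + 3 * b * u ^+ 2 * v + 3 * c * u * v ^+ 2 + d * v ^+ 3.

Definition disc f : R :=
  let: Cubic a b c d := f in
  a ^+ 2 * d ^+ 2 - 6 * a * b * c * d + 4 * a * c ^+ 3 + 4 * b ^+ 3 * d
    - 3 * b ^+ 2 * c ^+ 2.

(** The form [(g . f)(u, v) = f((u, v) g)]; see [cubic_eval_act]. *)
Definition cubic_act g f : cubic R :=
  let: Cubic a b c d := f in
  let: (p, q, r, s) := (g 0 0, g 0 1, g 1 0, g 1 1) in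
  Cubic
    (a * p ^+ 3 + 3 * b * p ^+ 2 * q + 3 * c * p * q ^+ 2 + d * q ^+ 3)
    (a * p ^+ 2 * r + b * (p ^+ 2 * s + 2 * p * q * r)
       + c * (2 * p * q * s + q ^+ 2 * r) + d * q ^+ 2 * s)
    (a * p * r ^+ 2 + b * (2 * p * r * s + q * r ^+ 2)
       + c * (p * s ^+ 2 + 2 * q * r * s) + d * q * s ^+ 2)
    (a * r ^+ 3 + 3 * b * r ^+ 2 * s + 3 * c * r * s ^+ 2 + d * s ^+ 3).

Lemma cubic_eval_act g f u v :
  cubic_eval (cubic_act g f) u v =
  cubic_eval f (u * g 0 0 + v * g 1 0) (u * g 0 1 + v * g 1 1).
Proof. by case: f => a b c d; rewrite /cubic_act /cubic_eval; ring. Qed.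

Lemma cubic_act1 f : cubic_act 1%:M f = f.
Proof. by case: f => a b c d; rewrite /cubic_act !mxE/=; congr Cubic; ring. Qed.

Lemma cubic_actM g h f : cubic_act (g *m h) f = cubic_act g (cubic_act h f).
Proof.
case: f => a b c d; rewrite /cubic_act !mxE !big_ord_recl !big_ord0.
rewrite (_ : lift ord0 ord0 = 1 :> 'I_2); last exact/val_inj.
by congr Cubic; ring.
Qed.

Lemma det_mx2 g : \det g = g 0 0 * g 1 1 - g 0 1 * g 1 0.
Proof.
rewrite (expand_det_row _ 0) !big_ord_recl big_ord0 /cofactor !det_mx11 !mxE.
have l0 : lift ord0 ord0 = 1 :> 'I_2 by exact/val_inj.
have l1 : lift (1 : 'I_2) ord0 = 0 :> 'I_2 by exact/val_inj.
by rewrite /= !l0 !l1 /=; ring.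
Qed.

Lemma disc_act g f : disc (cubic_act g f) = \det g ^+ 6 * disc f.
Proof. by rewrite det_mx2; case: f => a b c d; rewrite /cubic_act /disc; ring. Qed.

Definition SL2 : set 'M[R]_2 := [set g | \det g = 1].

Definition SL2_orbit f : set (cubic R) := [set cubic_act g f | g in SL2].

Definition cubics_of_disc (m : int) : set (cubic R) :=
  [set f | disc f = m%:~R].

Definition SL2_orbits_of_disc (m : int) : set (set (cubic R)) :=
  [set SL2_orbit f | f in cubics_of_disc m].

End Cubic.

Definition soluble_over (K : fieldType) (f : cubic rat) : Prop :=
  exists z u v : K, (z, u, v) <> (0, 0, 0) /\
    z ^+ 3 = cubic_eval (cubic_map ratr f) u v.

(** The places of [rat] are the real one and one for each prime [p]. *)
Definition locally_soluble (R : realType) (f : cubic rat) : Prop :=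
  soluble_over R f /\
  forall (p : nat) (p_pr : prime p), soluble_over (Qp p_pr) f.

(* Main.v *)
(** A p-adic solution of [z^3 = f(u, v)] yields rational [u, v] such that the
    valuation of [f(u, v)] is a finite multiple of 3: approximate the solution
    if [z != 0], and perturb the simple root [(u, v)] of [f] otherwise.  Moving
    a rescaling of [(u, v)] to [(1, 0)] gives a form with p-adic unit leading
    coefficient, and an explicit translation and scaling makes it p-integral.
    By strong approximation for SL2, this transformation can be taken in
    SL2(Z[1/p]), so that it does not affect integrality at the other primes; the
    finitely many bad primes are thus treated one after the other. *)

Require Import Defs.
From HB Require Import structures.
From mathcomp Require Import all_boot all_order all_algebra.
From mathcomp Require Import boolp classical_sets reals.
From mathcomp Require Import cyclic.
From mathcomp Require Import ring lra.

Set Implicit Arguments.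
Unset Strict Implicit.
Unset Printing Implicit Defensive.

Import Order.TTheory GRing.Theory Num.Theory.

Local Open Scope ring_scope.
Local Open Scope classical_set_scope.

(** * p-adic norm and integrality of rational numbers *)

Section PadicInt.
Variables (p : nat) (p_pr : prime p).
Local Notation norm := (padic_norm p).

(* [p_pr] is an argument only so that the closure instances can be inferred. *)
Definition padic_int of prime p : {pred rat} := fun x => norm x <= 1.

Lemma padic_intE x : (x \in padic_int p_pr) = (norm x <= 1).
Proof. by []. Qed.

Fact padic_int_subring : subring_closed (padic_int p_pr).
Proof.
split=> [|x y|x y]; rewrite !padic_intE ?padic_norm1// => x1 y1.
  by rewrite (le_trans (padic_normD _ _ _))// ge_max padic_normN x1.
by rewrite padic_normM// mulr_ile1 ?padic_norm_ge0.
Qed.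
HB.instance Definition _ :=
  GRing.isSubringClosed.Build _ (padic_int p_pr) padic_int_subring.

Lemma padic_normX x n : norm (x ^+ n) = norm x ^+ n.
Proof.
elim: n => [|n IHn]; first by rewrite !expr0 padic_norm1.
by rewrite !exprS padic_normM// IHn.
Qed.

(** Isosceles principle: if [x + y] were smaller than [x], subtracting the smaller [y] would make
    [x] smaller than itself. *)
Lemma padic_normDl x y : norm y < norm x -> norm (x + y) = norm x.
Proof.
move=> yx; apply/eqP; rewrite eq_le; apply/andP; split.
  by rewrite (le_trans (padic_normD _ _ _))// ge_max lexx ltW.
rewrite leNgt; apply/negP => xyx.
have : norm (x + y - y) < norm x by rewrite padic_normD_lt ?padic_normN.
by rewrite addrK ltxx.
Qed.

Lemma padic_int_denq x : (x \in padic_int p_pr) = ~~ (p %| `|denq x|)%N.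
Proof.
have p0 : (0 : rat) < p%:R by rewrite ltr0n prime_gt0.
have p1 : (1 : rat) < p%:R by rewrite ltr1n prime_gt1.
rewrite padic_intE /padic_norm; case: eqVneq => [->|x0].
  by rewrite ler01 dvdn1 gtn_eqF ?prime_gt1.
rewrite -(expr0z (p%:R : rat)) ler_eXz2l// oppr_le0 /padic_val.
have cop := coprime_num_den x.
have [pd|pd] := boolP (p %| _)%N.
  have pn : ~~ (p %| `|numq x|)%N.
    apply/negP => pn; have : (p %| 1)%N by rewrite -(eqP cop) dvdn_gcd pn.
    by rewrite dvdn1 gtn_eqF ?prime_gt1.
  rewrite (lognE _ `|numq x|) (negPf pn) !andbF sub0r oppr_ge0.
  rewrite lez_nat leqn0 eqn0Ngt logn_gt0 mem_primes p_pr pd.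
  by rewrite absz_gt0 denq_eq0.
by rewrite (lognE _ `|denq x|) (negPf pd) !andbF subr0.
Qed.

Lemma padic_norm_nat n : (0 < n)%N -> norm n%:R = p%:R ^- logn p n.
Proof. by move=> n0; rewrite pmulrn padic_norm_int//; case: n n0. Qed.

Lemma padic_norm_pX n : norm (p%:R ^+ n) = p%:R ^- n.
Proof.
by rewrite padic_normX padic_norm_nat ?prime_gt0// logn_prime// eqxx exprVn.
Qed.

Lemma padic_normX_small (C e : rat) : 0 < e ->
  exists n, forall m, (n <= m)%N -> C * norm (p%:R ^+ m) < e.
Proof.
move=> e0; exists (Num.bound `|C / e|) => m nm; rewrite padic_norm_pX.
have p0 : (0 : rat) < p%:R ^+ m by rewrite exprn_gt0// ltr0n prime_gt0.
rewrite ltr_pdivrMr// -ltr_pdivrMl// mulrC.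
apply: le_lt_trans (ler_norm _) _.
apply: lt_le_trans (archi_boundP (normr_ge0 _)) _.
rewrite -natrX ler_nat (leq_trans nm)// ltnW// ltn_expl// prime_gt1//.
Qed.

End PadicInt.

(** A denominator greater than 1 has a prime divisor, at which [x] is not integral. *)
Lemma rat_intP x : (forall p (p_pr : prime p), x \in padic_int p_pr) ->
  (numq x)%:~R = x.
Proof.
move=> xint; have [d1|] := leqP `|denq x| 1.
  apply: numqK; rewrite Qint_def.
  have : (0 < `|denq x|)%N by rewrite absz_gt0 denq_eq0.
  by move: d1 (denq_gt0 x); case: (denq x) => [[|[]]|].
by move=> /pdiv_prime qpr; have := xint _ qpr; rewrite padic_int_denq pdiv_dvd.
Qed.

(** Density of [Z[1/p]] in the rationals for the [p]-adic norm. Multiplying [x] by [1 - p ^ L]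
    changes it little [p]-adically when [L] is large, and clears the prime-to-[p] part [b] of its
    denominator when [b] divides [p ^ L - 1]. *)
Lemma padic_approx p (p_pr : prime p) (x e : rat) : 0 < e ->
  exists2 y, padic_norm p (x - y) < e &
    forall q (q_pr : prime q), q != p -> y \in padic_int q_pr.
Proof.
move=> e0; set D := `|denq x|%N.
have D0 : (0 < D)%N by rewrite absz_gt0 denq_eq0.
set j := (D`_p)%N; set b := (D`_p^')%N.
have jb : D = (j * b)%N by rewrite partnC.
have pb : coprime p b by rewrite -(@part_pnat_id p p) ?coprime_partC ?pnat_id.
have [n nP] := padic_normX_small p_pr (padic_norm p x) e0.
have b0 : (0 < b)%N by rewrite part_gt0.
have j0 : (0 < j)%N by rewrite part_gt0.
(* A multiple of [totient b], for Euler's congruence [p ^ L = 1] modulo [b], and at least [n], for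
   the approximation. *)
set L := (totient b * n)%N.
have nL : (n <= L)%N by rewrite leq_pmull// totient_gt0.
have : (b %| p ^ L - 1)%N.
  rewrite -eqn_mod_dvd ?expn_gt0 ?prime_gt0//.
  by rewrite /L expnM -modnXm Euler_exp_totient// modnXm exp1n.
move=> /dvdnP[m mP].
have pL : p%:R ^+ L = 1 + m%:R * b%:R :> rat.
  by rewrite -natrX -natrM -mP addrC -(natrD _ _ 1) subnK ?expn_gt0 ?prime_gt0.
exists (x * (1 - p%:R ^+ L)).
  rewrite [X in padic_norm _ X](_ : _ = x * p%:R ^+ L); last by ring.
  by rewrite padic_normM// nP.
move=> q q_pr qp.
have xE : x = (numq x)%:~R / (j%:R * b%:R).
  rewrite -natrM -jb /D -{1}(divq_num_den x); congr (_ / _).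
  by rewrite -[in LHS](@gtz0_abs (denq x)) ?denq_gt0.
have -> : x * (1 - p%:R ^+ L) = (numq x)%:~R * - m%:R * j%:R^-1.
  rewrite pL {1}xE; field.
  by rewrite !pnatr_eq0 -!lt0n j0.
rewrite rpredM// ?rpredM ?rpredN ?rpred_nat ?rpred_int//.
rewrite padic_intE padic_normV// padic_norm_nat// (_ : logn q j = 0)%N ?invr1//.
by rewrite /j p_part lognX (logn_prime q p_pr) (negPf qp) muln0.
Qed.

(** * Explicit 2 by 2 matrices and integral forms *)

Section Mx2.
Variable R : comNzRingType.

Definition mx2 (x y z w : R) : 'M[R]_2 :=
  \matrix_(i, j) if i == 0 then if j == 0 then x else y
                 else if j == 0 then z else w.

Lemma mx2E (g : 'M[R]_2) : g = mx2 (g 0 0) (g 0 1) (g 1 0) (g 1 1).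
Proof.
apply/matrixP => i j; rewrite mxE.
have I2 (k : 'I_2) : k = if k == 0 then 0 else 1.
  by case: k => [[|[|k]] ?]//; apply/val_inj.
by rewrite [in LHS](I2 i) [in LHS](I2 j); do 2 case: ifP.
Qed.

Lemma mul_mx2 x y z w x' y' z' w' :
  mx2 x y z w *m mx2 x' y' z' w' =
  mx2 (x * x' + y * z') (x * y' + y * w') (z * x' + w * z') (z * y' + w * w').
Proof.
rewrite [LHS]mx2E.
by congr mx2; rewrite !mxE !big_ord_recl big_ord0 !mxE/= addr0.
Qed.

Lemma det_mx2E x y z w : \det (mx2 x y z w) = x * w - y * z.
Proof. by rewrite det_mx2 !mxE. Qed.

Lemma cubic_act_mx2 p q r s a b c d :
  cubic_act (mx2 p q r s) (Cubic a b c d) =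
  Cubic
    (a * p ^+ 3 + 3 * b * p ^+ 2 * q + 3 * c * p * q ^+ 2 + d * q ^+ 3)
    (a * p ^+ 2 * r + b * (p ^+ 2 * s + 2 * p * q * r)
       + c * (2 * p * q * s + q ^+ 2 * r) + d * q ^+ 2 * s)
    (a * p * r ^+ 2 + b * (2 * p * r * s + q * r ^+ 2)
       + c * (p * s ^+ 2 + 2 * q * r * s) + d * q * s ^+ 2)
    (a * r ^+ 3 + 3 * b * r ^+ 2 * s + 3 * c * r * s ^+ 2 + d * s ^+ 3).
Proof. by rewrite /cubic_act !mxE. Qed.

End Mx2.

(** The condition bears on [b] and [c] themselves, not on the coefficients [3b] and [3c], as in the
    definition of [V(S)]. *)
Definition cubic_over (R : Type) (S : {pred R}) (f : cubic R) : Prop :=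
  [/\ cubA f \in S, cubB f \in S, cubC f \in S & cubD f \in S].

Lemma cubic_act_over (R : comNzRingType) (S : subringClosed R) (g : 'M_2) f :
  (forall i j, g i j \in S) -> cubic_over S f -> cubic_over S (cubic_act g f).
Proof.
case: f => a b c d gS [/= aS bS cS dS]; split=> /=;
  by rewrite !(rpredD, rpredM, rpredX, rpred1, rpred_nat).
Qed.

(** * Strong approximation for SL2 at one prime *)

(** [P] is the power of [p] in [x]. Being a unit at every other prime, it can replace [x] on a
    diagonal without harm there. *)
Lemma padic_normX_p_prime p (p_pr : prime p) (x : rat) : x != 0 ->
  exists P, [/\ P != 0, padic_norm p P = padic_norm p x
    & forall q (q_pr : prime q), q != p -> padic_norm q P = 1].
Proof.
move=> x0; have p0 : (p%:R : rat) != 0 by rewrite pnatr_eq0 -lt0n prime_gt0.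
have norm1n q (q_pr : prime q) (n : int) :
    padic_norm q (p%:R ^ n) = padic_norm q p%:R ^ n.
  by case: n => n; rewrite ?NegzE -?exprnN ?padic_normV// -?exprnP padic_normX.
exists (p%:R ^ padic_val p x); split; first exact: expfz_neq0.
  rewrite norm1n// padic_norm_nat ?prime_gt0// logn_prime// eqxx expr1.
  by rewrite exprz_inv /padic_norm (negPf x0).
move=> q q_pr qp; rewrite norm1n// padic_norm_nat ?prime_gt0//.
by rewrite logn_prime// (negPf qp) expr0 invr1 exp1rz.
Qed.

(* Strong approximation: SL2(Q) = SL2(Z_(p)) SL2(Z[1/p]). *)
Lemma SL2_strong_approx p (p_pr : prime p) (M : 'M[rat]_2) : \det M = 1 ->
  exists g, [/\ \det g = 1, forall i j, g i j \in padic_int p_pr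
    & forall q (q_pr : prime q), q != p ->
        forall i j, (g *m M) i j \in padic_int q_pr].
Proof.
move=> Mdet; have mx2_in q (q_pr : prime q) x y z w : x \in padic_int q_pr ->
    y \in padic_int q_pr -> z \in padic_int q_pr -> w \in padic_int q_pr ->
    forall i j, mx2 x y z w i j \in padic_int q_pr.
  by move=> *; rewrite mxE; do 2 case: ifP.
have triang (a b : rat) : a != 0 -> exists g, [/\ \det g = 1,
    forall i j, g i j \in padic_int p_pr & forall q (q_pr : prime q), q != p ->
    forall i j, (g *m mx2 a b 0 a^-1) i j \in padic_int q_pr].
  move=> a0; have [P [P0 PN Pq]] := padic_normX_p_prime p_pr a0.
  have aN0 : 0 < padic_norm p a by rewrite padic_norm_gt0.
  have : 0 < (padic_norm p a)^-1 by rewrite invr_gt0.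
  move=> /(padic_approx p_pr (b * P / a))[y yN yq].
  (* Chosen so that the product with [mx2 a b 0 a^-1] is [mx2 P y 0 P^-1]. The upper right entry is
     [p]-integral because [y] is within [(padic_norm p a)^-1] of [b * P / a]. *)
  exists (mx2 (P / a) ((y - b * P / a) * a) 0 (a / P)); split.
  - by rewrite det_mx2E; field; rewrite a0 P0.
  - apply: mx2_in; rewrite ?rpred0// padic_intE padic_normM// ?padic_normV//.
    + by rewrite PN mulfV// gt_eqF.
    + by rewrite -ler_pdivlMr// mul1r padic_normB ltW.
    + by rewrite PN mulfV// gt_eqF.
  - move=> q q_pr qp; rewrite mul_mx2; apply: mx2_in.
    + by rewrite mulr0 addr0 divfK// padic_intE Pq.
    + rewrite [X in X \in _](_ : _ = y) ?yq//; field.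
      by rewrite a0.
    + by rewrite mul0r mulr0 addr0 rpred0.
    + rewrite mul0r add0r [X in X \in _](_ : _ = P^-1); last first.
        by field; rewrite a0 P0.
      by rewrite padic_intE padic_normV// Pq// invr1.
(* It remains to make [M] upper triangular by [p]-integral row operations: the entry of larger norm
   in the first column serves as pivot, so that the quotient of the two entries is [p]-integral. *)
suff red : exists h, [/\ \det h = 1, forall i j, h i j \in padic_int p_pr
    & exists2 a, a != 0 & exists b, h *m M = mx2 a b 0 a^-1].
  have [h [hdet hint [a a0 [b hM]]]] := red.
  have [g [gdet gint gq]] := triang a b a0.
  exists (g *m h); split; first by rewrite det_mulmx gdet hdet mulr1.
    by move=> i j; rewrite mxE rpred_sum// => k _; rewrite rpredM.
  by move=> q q_pr qp i j; rewrite -mulmxA hM gq.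
move: Mdet; rewrite (mx2E M); move: (M 0 0) (M 0 1) (M 1 0) (M 1 1) => x y z w.
rewrite det_mx2E => det1; have [zx|xz] := leP (padic_norm p z) (padic_norm p x).
  have x0 : x != 0.
    apply: contraPneq det1 => x0; rewrite x0 padic_norm0 in zx *.
    have : padic_norm p z == 0 by rewrite eq_le zx padic_norm_ge0.
    rewrite padic_norm_eq0// => /eqP ->.
    by rewrite mul0r mulr0 subr0 => /eqP; rewrite eq_sym oner_eq0.
  exists (mx2 1 0 (- z / x) 1); split; first by rewrite det_mx2E; ring.
    apply: mx2_in; rewrite ?rpred0 ?rpred1// padic_intE padic_normM//.
    by rewrite padic_normN padic_normV// ler_pdivrMr ?mul1r// padic_norm_gt0.
  exists x => //; exists y; rewrite mul_mx2; congr mx2; [ring|ring|by field|].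
  by apply: (mulIf x0); rewrite mulVf// -[RHS]det1; field.
have z0 : z != 0.
  rewrite -(padic_norm_eq0 p_pr) gt_eqF// (le_lt_trans _ xz)//.
  exact: padic_norm_ge0.
exists (mx2 0 1 (- 1) (x / z)); split; first by rewrite det_mx2E; ring.
  apply: mx2_in; rewrite ?rpred0 ?rpredN ?rpred1// padic_intE padic_normM//.
  by rewrite padic_normV// ler_pdivrMr ?mul1r ?ltW// padic_norm_gt0.
exists z => //; exists w; rewrite mul_mx2; congr mx2; [ring|ring|by field|].
by apply: (mulIf z0); rewrite mulVf// -[RHS]det1; field.
Qed.

(** * Integrality at one prime *)

(* After killing [b], the form [a, 0, c, d] either is already p-integral, or its
   translate by s = - d / (2 c) is
   [a, a s, k / (a c^2), s k / (a c^2)] with |s|^2 = |c| > 1, which becomes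
   integral once rescaled by 1 / s. *)
Lemma integral_orbit_of_unit p (p_pr : prime p) (k : int) (a b c d : rat) :
  disc (Cubic a b c d) = (4 * k)%:~R -> padic_norm p a = 1 ->
  exists2 g, \det g = 1 &
    cubic_over (padic_int p_pr) (cubic_act g (Cubic a b c d)).
Proof.
move=> dk a1; have a0 : a != 0 by rewrite -(padic_norm_eq0 p_pr) a1 oner_eq0.
wlog b0 : b c d dk / b = 0 => [hw|].
  (* The shear that depresses the cubic; it preserves [a] and the discriminant. *)
  pose h := mx2 1 0 (- b / a) 1.
  have hdet : \det h = 1 by rewrite det_mx2E; ring.
  case E : (cubic_act h (Cubic a b c d)) => [a' b' c' d'].
  have [a'E b'E] : a' = a /\ b' = 0.
    move: E; rewrite cubic_act_mx2 => -[<- <- _ _]; split; first by ring.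
    by field.
  have := disc_act h (Cubic a b c d).
  rewrite E a'E hdet expr1n mul1r dk => dk'.
  have [g gdet gint] := hw _ _ _ dk' b'E.
  exists (g *m h); first by rewrite det_mulmx gdet hdet mulr1.
  by rewrite cubic_actM E a'E.
rewrite {}b0 in dk *.
have kE : k%:~R = (a ^+ 2 * d ^+ 2 + 4 * a * c ^+ 3) / 4 :> rat.
  rewrite (_ : k%:~R = (4 * k)%:~R / 4); last by rewrite intrM; field.
  by rewrite -dk /disc; field.
have kint : padic_norm p k%:~R <= 1 by rewrite -(padic_intE p_pr) rpred_int.
(* If [c] is integral, so is [d], since [d ^+ 2] is [(4 k - 4 a c ^+ 3) / a ^+ 2]. *)
have [c1|c1] := leP (padic_norm p c) 1.
  exists 1%:M; first exact: det1.
  rewrite cubic_act1; split=> /=; rewrite ?padic_intE ?a1 ?padic_norm0//.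
  rewrite -(@ler_pXn2r _ 2) ?nnegrE ?padic_norm_ge0// expr1n -padic_normX//.
  rewrite (_ : d ^+ 2 = (4 * k%:~R - 4 * a * c ^+ 3) / a ^+ 2); last first.
    by rewrite kE; field.
  rewrite padic_normM// padic_normV// padic_normX// a1 expr1n invr1 mulr1.
  rewrite -(padic_intE p_pr) rpredB ?rpredM ?rpredX ?rpred_nat ?rpred_int//.
  by rewrite padic_intE a1.
have c0 : c != 0.
  by rewrite -(padic_norm_eq0 p_pr) gt_eqF// (lt_trans _ c1).
pose s := - d / (2 * c).
have sN : padic_norm p s ^+ 2 = padic_norm p c.
  (* The 4 of the discriminant [4 k] cancels the square of the 2 in [s], so the formula is usable at
     [p = 2] too. As [c] has norm above 1 and [k] is integral, [c ^+ 3] dominates [k / a]. *)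
  have sE : s ^+ 2 = (- c ^+ 3 + k%:~R / a) / (a * c ^+ 2).
    by rewrite kE /s; field; rewrite a0 c0.
  rewrite -padic_normX// sE padic_normM// padic_normDl//; last first.
    rewrite padic_normN padic_normM// padic_normV// a1 invr1 mulr1.
    by rewrite padic_normX// (le_lt_trans kint)// exprn_egt1.
  rewrite padic_normN padic_normV// padic_normM// !padic_normX// a1 mul1r.
  by field; rewrite padic_norm_eq0.
have s1 : 1 <= padic_norm p s.
  rewrite -(@ler_pXn2r _ 2) ?nnegrE ?padic_norm_ge0// expr1n sN ltW//.
have s0 : s != 0.
  by rewrite -(padic_norm_eq0 p_pr) gt_eqF// (lt_le_trans _ s1).
have d0 : d != 0 by apply: contraNneq s0; rewrite /s => ->; rewrite oppr0 mul0r.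
exists (mx2 s^-1 0 (s ^+ 2) s); first by rewrite det_mx2E; field.
rewrite cubic_act_mx2.
rewrite (_ : Cubic _ _ _ _ = Cubic (a / s ^+ 3) a
   (k%:~R / (a * c ^+ 2) * s) (s ^+ 4 / c ^+ 2 * k%:~R / a)); last first.
  by rewrite kE /s; congr Cubic; field; rewrite ?a0 ?c0 ?d0.
have i0 x : padic_norm p x <= 1 -> x \in padic_int p_pr by [].
have sV1 : (padic_norm p s)^-1 <= 1 by rewrite invf_le1// padic_norm_gt0.
have aVi : a^-1 \in padic_int p_pr by rewrite padic_intE padic_normV// a1 invr1.
have sVi : s^-1 \in padic_int p_pr by rewrite padic_intE padic_normV.
(* The last two coefficients are [k / a] times powers of the unit [s ^+ 2 / c] and of the integral
   [s^-1]. *)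
have scN : padic_norm p (s ^+ 2 / c) = 1.
  rewrite padic_normM// padic_normV// padic_normX// sN mulfV// gt_eqF//.
  exact: lt_trans c1.
have sci : (s ^+ 2 / c) \in padic_int p_pr by rewrite padic_intE scN.
have kai : k%:~R / a \in padic_int p_pr by rewrite rpredM ?rpred_int.
split=> /=.
- by rewrite -exprVn rpredM ?rpredX// i0 ?a1.
- by rewrite i0 ?a1.
- rewrite (_ : _ * s = k%:~R / a * (s ^+ 2 / c) ^+ 2 * s^-1 ^+ 3); last first.
    by field; rewrite a0 c0 s0.
  by rewrite rpredM ?[_ ^+ 3 \in _]rpredX// rpredM ?[_ ^+ 2 \in _]rpredX.
- rewrite (_ : _ / a = k%:~R / a * (s ^+ 2 / c) ^+ 2); last first.
    by field; rewrite a0 c0.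
  by rewrite rpredM ?[_ ^+ 2 \in _]rpredX.
Qed.

(** A matrix of determinant 1 with first row [(u / w, v / w)] turns the leading coefficient into
    [f(u, v) / w ^+ 3], a [p]-adic unit. *)
Lemma integral_orbit_of_cube_norm p (p_pr : prime p) (k : int) f (u v w : rat) :
  disc f = (4 * k)%:~R -> w != 0 ->
  padic_norm p (cubic_eval f u v) = padic_norm p w ^+ 3 ->
  exists2 g, \det g = 1 & cubic_over (padic_int p_pr) (cubic_act g f).
Proof.
move=> dk w0 fN; have wN0 : padic_norm p w != 0 by rewrite padic_norm_eq0.
have [h hdet [h0 h1]] : exists2 h : 'M[rat]_2,
    \det h = 1 & h 0 0 = u / w /\ h 0 1 = v / w.
  have [u0|u0] := eqVneq u 0; last first.
    exists (mx2 (u / w) (v / w) 0 (w / u)); last by rewrite !mxE.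
    by rewrite det_mx2E; field; rewrite u0 w0.
  (* If [u] and [v] both vanished, so would the form's value, hence the norm of [w]. *)
  have v0 : v != 0.
    apply: contraNneq wN0 => v0; have : padic_norm p w ^+ 3 == 0.
      rewrite -fN u0 v0 padic_norm_eq0//.
      by case: (f) => a b c d; apply/eqP; rewrite /cubic_eval; ring.
    by rewrite expf_eq0.
  exists (mx2 (u / w) (v / w) (- w / v) 0); last by rewrite !mxE.
  by rewrite det_mx2E u0; field; rewrite v0 w0.
case E : (cubic_act h f) => [a b c d].
have dk' := disc_act h f; rewrite E hdet expr1n mul1r dk in dk'.
have aE : a = cubic_eval f u v / w ^+ 3.
  have := cubic_eval_act h f 1 0; rewrite E h0 h1 => H.
  have -> : a = cubic_eval (Cubic a b c d) 1 0 by rewrite /cubic_eval; ring.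
  by rewrite H; case: (f) => *; rewrite /cubic_eval; field.
have a1 : padic_norm p a = 1.
  by rewrite aE padic_normM// padic_normV// padic_normX// fN mulfV// expf_neq0.
have [g gdet gint] := integral_orbit_of_unit p_pr dk' a1.
exists (g *m h); first by rewrite det_mulmx gdet hdet mulr1.
by rewrite cubic_actM E.
Qed.

(** * Evaluation, discriminant and action under ring morphisms *)

Lemma cubic_eval_map (R S : comNzRingType) (h : {rmorphism R -> S}) f u v :
  h (cubic_eval f u v) = cubic_eval (cubic_map h f) (h u) (h v).
Proof. by case: f => a b c d; rewrite /cubic_eval /=; ring. Qed.

Lemma cubic_evalZ (R : comNzRingType) (f : cubic R) t u v :
  cubic_eval f (t * u) (t * v) = t ^+ 3 * cubic_eval f u v.
Proof. by case: f => a b c d; rewrite /cubic_eval; ring. Qed.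

Lemma cubic_eval_swap (R : comNzRingType) (a b c d u v : R) :
  cubic_eval (Cubic d c b a) u v = cubic_eval (Cubic a b c d) v u.
Proof. by rewrite /cubic_eval; ring. Qed.

Lemma disc_map (R S : comNzRingType) (h : {rmorphism R -> S}) f :
  h (disc f) = disc (cubic_map h f).
Proof. by case: f => a b c d; rewrite /disc /=; ring. Qed.

Lemma cubic_act_map (R S : comNzRingType) (h : {rmorphism R -> S}) g f :
  cubic_map h (cubic_act g f) = cubic_act (map_mx h g) (cubic_map h f).
Proof.
by case: f => a b c d; rewrite /cubic_map /cubic_act /= !mxE; congr Cubic; ring.
Qed.

Lemma map_mx2 (R S : comNzRingType) (h : R -> S) x y z w :
  map_mx h (mx2 x y z w) = mx2 (h x) (h y) (h z) (h w).
Proof. by apply/matrixP => i j; rewrite !mxE; do 2 case: ifP. Qed.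

Lemma cubA_act_translate (R : comNzRingType) (f : cubic R) y :
  cubA (cubic_act (mx2 1 y 0 1) f) = cubic_eval f 1 y.
Proof. by case: f => a b c d; rewrite cubic_act_mx2 /cubic_eval /=; ring. Qed.

(** * From [p]-adic solutions to rational values whose norm is a cube *)

Section PadicSequences.
Variables (p : nat) (p_pr : prime p).
Local Notation norm := (padic_norm p).
Local Notation Qp := (Qp p_pr).
Local Notation to_Qp := (@to_Qp p p_pr).
Local Notation cauchy := (cauchy_seq p_pr).
Implicit Types x y : cauchy.

(** As a ring morphism, this specializes polynomial identities between Cauchy sequences to rational
    ones, while [to_Qp] carries the same identities to the completion. *)
Definition cauchy_term (n : nat) x : rat := val x n.

Fact cauchy_term_zmod n : zmod_morphism (cauchy_term n).
Proof. by []. Qed.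
Fact cauchy_term_monoid n : monoid_morphism (cauchy_term n).
Proof. by []. Qed.
HB.instance Definition _ n :=
  GRing.isZmodMorphism.Build cauchy rat (cauchy_term n) (cauchy_term_zmod n).
HB.instance Definition _ n :=
  GRing.isMonoidMorphism.Build cauchy rat (cauchy_term n)
    (cauchy_term_monoid n).

Lemma to_Qp_cubic_cst (f : cubic rat) :
  cubic_map to_Qp (cubic_map (cauchy_cst p_pr) f) = cubic_map ratr f.
Proof. by case: f => a b c d; rewrite /cubic_map /= !ratr_Qp. Qed.

Lemma cauchy_term_cubic_cst (f : cubic rat) n :
  cubic_map (cauchy_term n) (cubic_map (cauchy_cst p_pr) f) = f.
Proof. by case: f. Qed.

Lemma cauchy_eventually x : exists2 C, 0 < C &
  exists N, forall n, (N <= n)%N -> norm (cauchy_term n x) < C.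
Proof. exact: padic_cauchy_bounded (cauchy_seqP x). Qed.

Lemma to_Qp_neq0_away x : to_Qp x != 0 -> exists2 c, 0 < c &
  exists N, forall n, (N <= n)%N -> c <= norm (cauchy_term n x).
Proof.
move=> x0; apply: padic_cauchy_away (cauchy_seqP x) _ => // /to_Qp_eq0 /eqP.
exact/negP.
Qed.

Lemma to_Qp_eq0_small x : to_Qp x = 0 -> forall e, 0 < e ->
  exists N, forall n, (N <= n)%N -> norm (cauchy_term n x) < e.
Proof. by move=> /to_Qp_eq0. Qed.

(* The increment [w = 9 b^2 t^3] makes the linear term [3 b w] the cube of
   [3 b t], and for small [t] it dominates the other terms. *)
Lemma cube_norm_near_root (a b c d t C : rat) :
  0 < C -> norm b < C -> norm c < C -> norm d < C -> b != 0 ->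
  C ^+ 2 * norm t < 1 -> C ^+ 4 * norm t < 1 -> norm t < 1 ->
  norm a < norm (3 * b * t) ^+ 3 ->
  norm (cubic_eval (Cubic a b c d) 1 (9 * b ^+ 2 * t ^+ 3))
    = norm (3 * b * t) ^+ 3.
Proof.
move=> C0 bC cC dC b0 Ct2 Ct4 t1 aN.
have n0 (r : rat) : 0 <= norm r := padic_norm_ge0 p_pr r.
have nat1 m : norm m%:R <= 1 by rewrite -(padic_intE p_pr) rpred_nat.
have dominant (S e x y : rat) : norm e < norm S -> norm x < 1 ->
    norm y < 1 -> norm (S + (e + (S * x + S * y))) = norm S.
  move=> eS x1 y1; have S0 : 0 < norm S := le_lt_trans (n0 e) eS.
  rewrite padic_normDl//; apply: padic_normD_lt => //.
  by apply: padic_normD_lt => //; rewrite padic_normM// gtr_pMr.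
have small (m i j : nat) (x : rat) : norm x <= C ^+ i -> C ^+ i * norm t < 1 ->
    norm (m%:R * x * t ^+ j.+1) < 1.
  move=> xC xt; rewrite !padic_normM// padic_normX// exprSr mulrA.
  apply: (@le_lt_trans _ _ (C ^+ i * norm t)) => //.
  rewrite ler_wpM2r// -[leRHS]mul1r -[leRHS]mulr1 ler_pM ?mulr_ge0 ?exprn_ge0//.
    by rewrite ler_pM.
  by rewrite exprn_ile1// ltW.
set s := 3 * b * t.
(* The quadratic and cubic terms are [s ^+ 3] times factors containing [b * c] and [b ^+ 3 * d], of
   norm at most [C ^+ 2] and [C ^+ 4]; the smallness conditions on [t] make both factors smaller
   than 1. *)
rewrite -padic_normX// [X in norm X = _](_ : _ =
  s ^+ 3 + (a + (s ^+ 3 * (9 * (b * c) * t ^+ 3)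
                 + s ^+ 3 * (27 * (b ^+ 3 * d) * t ^+ 6)))); last first.
  by rewrite /s /cubic_eval; ring.
apply: dominant; first by rewrite padic_normX.
  apply: (small 9 2 2%N _ _ Ct2).
  by rewrite padic_normM// expr2 ler_pM// ltW.
apply: (small 27 4 5%N _ _ Ct4).
rewrite padic_normM// padic_normX// (exprSr _ 3) ler_pM ?exprn_ge0//.
  by rewrite lerXn2r ?nnegrE ?n0 ?(ltW C0) ?(ltW bC).
exact: ltW.
Qed.

Lemma cube_norm_of_root (f : cubic rat) (y : Qp) : disc f != 0 ->
  cubic_eval (cubic_map ratr f) 1 y = 0 ->
  exists u v w, w != 0 /\ norm (cubic_eval f u v) = norm w ^+ 3.
Proof.
have [{}y <-] := to_Qp_surj y => f0 fy.
(* The root is translated to [(1, 0)] over the ring of Cauchy sequences, so that the translated form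
   can be read both in [Qp] and term by term. *)
pose g : 'M[cauchy]_2 := mx2 1 y 0 1.
case EF : (cubic_act g (cubic_map (cauchy_cst p_pr) f)) => [A B C D].
have FQ := cubic_act_map to_Qp g (cubic_map (cauchy_cst p_pr) f).
rewrite EF to_Qp_cubic_cst map_mx2 rmorph0 rmorph1 in FQ.
have A0 : to_Qp A = 0.
  by have := congr1 (@cubA _) FQ; rewrite cubA_act_translate fy.
(* The root is simple: with both [A] and [B] zero the discriminant would vanish. *)
have B0 : to_Qp B != 0.
  apply: contraNneq f0 => B0; rewrite -(fmorph_eq0 (to_Qp \o cauchy_cst p_pr)).
  rewrite /= !disc_map to_Qp_cubic_cst.
  have := disc_act (mx2 1 (to_Qp y) 0 1) (cubic_map ratr f).
  rewrite -FQ det_mx2E mulr0 subr0 mulr1 expr1n mul1r => <-.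
  by rewrite /cubic_map /= A0 B0; apply/eqP; ring.
have [beta beta0 [N0 HB]] := to_Qp_neq0_away B0.
have [MB MB0 [N1 HMB]] := cauchy_eventually B.
have [MC MC0 [N2 HMC]] := cauchy_eventually C.
have [MD MD0 [N3 HMD]] := cauchy_eventually D.
pose M := MB + MC + MD.
have M0 : 0 < M by rewrite !addr_gt0.
(* One bound with the factor [1 + M ^+ 2 + M ^+ 4] gives all three smallness conditions on [t]. *)
have [T HT] := padic_normX_small p_pr (1 + M ^+ 2 + M ^+ 4) ltr01.
pose t : rat := p%:R ^+ T.
have {HT} := HT T (leqnn T); rewrite -/t !mulrDl mul1r => tM.
have tN : 0 < norm t.
  by rewrite padic_norm_gt0// expf_neq0// pnatr_eq0 -lt0n prime_gt0.
have tM2 : 0 < M ^+ 2 * norm t by rewrite mulr_gt0// exprn_gt0.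
have tM4 : 0 < M ^+ 4 * norm t by rewrite mulr_gt0// exprn_gt0.
have n30 : 0 < norm 3 by rewrite padic_norm_gt0.
(* The order of choices matters: [t] is fixed from the bound [M], valid for all large [n]; then [n]
   is taken so large that the null sequence [A] falls below this threshold, where [beta] bounds the
   norm of every late term of [B] from below. *)
have e0 : 0 < (norm 3 * beta * norm t) ^+ 3 by rewrite exprn_gt0// !mulr_gt0.
have [N4 HA] := to_Qp_eq0_small A0 e0.
pose n := maxn N0 (maxn N1 (maxn N2 (maxn N3 N4))).
have bn : beta <= norm (cauchy_term n B) by apply: HB; rewrite leq_max leqnn.
have lb : norm (cauchy_term n B) < M.
  by rewrite (lt_trans (HMB n _)) /n ?leq_max ?leqnn ?orbT// /M; lra.
have lc : norm (cauchy_term n C) < M.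
  by rewrite (lt_trans (HMC n _)) /n ?leq_max ?leqnn ?orbT// /M; lra.
have ld : norm (cauchy_term n D) < M.
  by rewrite (lt_trans (HMD n _)) /n ?leq_max ?leqnn ?orbT// /M; lra.
have la : norm (cauchy_term n A) < (norm 3 * beta * norm t) ^+ 3.
  by apply: HA; rewrite !leq_max leqnn !orbT.
have b0 : cauchy_term n B != 0.
  by rewrite -(padic_norm_eq0 p_pr) gt_eqF// (lt_le_trans beta0).
have := cube_norm_near_root (a := cauchy_term n A) (t := t) M0 lb lc ld b0.
set w := 9 * _ * _ => H.
(* Undoing the translation, the point [(1, w)] of the translated form is [(1, y + w)] for [f]. *)
exists 1, (cauchy_term n y + w), (3 * cauchy_term n B * t); split.
  rewrite -(padic_norm_eq0 p_pr) !padic_normM// !mulf_neq0// gt_eqF//.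
  exact: padic_norm_gt0.
rewrite -H; last 4 first.
- by lra.
- by lra.
- by lra.
- apply: (lt_le_trans la); rewrite ler_pXn2r ?nnegrE ?padic_norm_ge0//.
    by rewrite !padic_normM// ler_pM2r// ler_pM2l.
  by rewrite ltW// !mulr_gt0.
have Fn := cubic_act_map (cauchy_term n) g (cubic_map (cauchy_cst p_pr) f).
rewrite EF cauchy_term_cubic_cst map_mx2 rmorph0 rmorph1 in Fn.
rewrite [Cubic _ _ _ _]Fn cubic_eval_act !mxE /=.
by rewrite !(mul1r, mulr1, mulr0, addr0).
Qed.

Lemma soluble_cube_norm (f : cubic rat) : disc f != 0 -> soluble_over Qp f ->
  exists u v w, w != 0 /\ norm (cubic_eval f u v) = norm w ^+ 3.
Proof.
move=> f0 [z [u [v [nz fz]]]].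
have [z0|z0] := eqVneq z 0; last first.
  have [Z ZE] := to_Qp_surj z; have [U UE] := to_Qp_surj u.
  have [V VE] := to_Qp_surj v.
  rewrite -ZE in z0; have [c c0 [N HN]] := to_Qp_neq0_away z0.
  (* The error [E] tends to 0 whereas the terms of [Z] stay away from 0, so eventually [f(U, V)] has
     exactly the norm of [Z ^+ 3]. *)
  pose E := cubic_eval (cubic_map (cauchy_cst p_pr) f) U V - Z ^+ 3.
  have E0 : to_Qp E = 0.
    rewrite rmorphB rmorphXn cubic_eval_map to_Qp_cubic_cst /=.
    by rewrite UE VE ZE fz subrr.
  have [N' HN'] := to_Qp_eq0_small E0 (exprn_gt0 3 c0).
  pose n := maxn N N'.
  have cn := HN n (leq_maxl _ _); have En := HN' n (leq_maxr _ _).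
  exists (cauchy_term n U), (cauchy_term n V), (cauchy_term n Z); split.
    by rewrite -(padic_norm_eq0 p_pr) gt_eqF// (lt_le_trans c0).
  rewrite -[f in cubic_eval f](cauchy_term_cubic_cst f n) -cubic_eval_map.
  rewrite -(subrK (Z ^+ 3) (cubic_eval _ _ _)) -/E.
  rewrite addrC rmorphD rmorphXn padic_normDl ?padic_normX//.
  by rewrite (lt_le_trans En)// lerXn2r ?nnegrE ?padic_norm_ge0// ltW.
have {}fz : cubic_eval (cubic_map ratr f) u v = 0 by rewrite -fz z0 expr0n.
(* For [z = 0] the point is a projective root: [(1, v / u)] when [u] is nonzero, and otherwise
   [(0, 1)], which swapping the variables turns into [(1, 0)]. *)
have [u0|u0] := eqVneq u 0; last first.
  apply: (@cube_norm_of_root f (v / u)) => //.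
  apply: (mulfI (expf_neq0 3 u0)).
  by rewrite mulr0 -cubic_evalZ mulr1 mulrCA mulfV// mulr1.
have v0 : v != 0 by apply/eqP => v0; apply: nz; rewrite z0 u0 v0.
case: f f0 fz => a b c d f0; rewrite u0 => fz.
have [||u' [v' [w [w0 E]]]] := @cube_norm_of_root (Cubic d c b a) 0.
- by move: f0; congr (_ != 0); rewrite /disc; ring.
- apply: (mulfI (expf_neq0 3 v0)).
  by rewrite mulr0 -cubic_evalZ mulr1 mulr0 cubic_eval_swap.
by exists v', u', w; rewrite -E cubic_eval_swap.
Qed.

End PadicSequences.

(** * From one prime to all primes *)

(** [M] makes the form integral at [p]; the [p]-integral [g] preserves this and makes [g *m M]
    integral at all other primes. *)
Lemma exists_padic_integral p (p_pr : prime p) (k : int) (f : cubic rat) :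
  k != 0 -> disc f = (4 * k)%:~R -> soluble_over (Qp p_pr) f ->
  exists2 g, \det g = 1 & cubic_over (padic_int p_pr) (cubic_act g f) /\
    forall q (q_pr : prime q), q != p -> cubic_over (padic_int q_pr) f ->
      cubic_over (padic_int q_pr) (cubic_act g f).
Proof.
move=> k0 dk sol; have f0 : disc f != 0 by rewrite dk intr_eq0 mulf_neq0.
have [u [v [w [w0 fN]]]] := soluble_cube_norm f0 sol.
have [M Mdet Mint] := integral_orbit_of_cube_norm p_pr dk w0 fN.
have [g [gdet gint gq]] := SL2_strong_approx p_pr Mdet.
exists (g *m M); first by rewrite det_mulmx gdet Mdet mulr1.
split=> [|q q_pr qp fq]; first by rewrite cubic_actM; exact: cubic_act_over.
by apply: cubic_act_over => //; exact: gq.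
Qed.

(** The exceptional primes are the divisors of the denominators. *)
Lemma cubic_over_padic_ae (f : cubic rat) : exists s : seq nat,
  forall q (q_pr : prime q), q \notin s -> cubic_over (padic_int q_pr) f.
Proof.
case: f => a b c d.
pose D (x : rat) := primes `|denq x|.
exists (D a ++ D b ++ D c ++ D d) => q q_pr; rewrite !mem_cat !negb_or.
have Dq x : q \notin D x -> x \in padic_int q_pr.
  by rewrite mem_primes q_pr absz_gt0 denq_eq0 padic_int_denq.
by case/and4P => *; split; apply: Dq.
Qed.

Theorem theorem24 (R : realType) (k : int) (k_neq0 : k != 0)
    (k_dvd3 : (3 %| k)%Z) (O : set (cubic rat))
    (O_orbit : SL2_orbits_of_disc (4 * k) O)
    (O_soluble : forall f : cubic rat, O f -> locally_soluble R f) :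
  exists F : cubic int,
    cubics_of_disc (4 * k) F /\ O (cubic_map (fun n : int => n%:~R) F).
Proof.
case: O_orbit O_soluble => f0 dk0 <- O_soluble.
have Odisc f : SL2_orbit f0 f -> disc f = (4 * k)%:~R.
  by case=> g gdet <-; rewrite disc_act (gdet : \det g = 1) expr1n mul1r.
have Oact f g : SL2_orbit f0 f -> \det g = 1 -> SL2_orbit f0 (cubic_act g f).
  move=> [h hdet <-] gdet; exists (g *m h); last exact: cubic_actM.
  by rewrite /SL2 /= det_mulmx gdet (hdet : \det h = 1) mulr1.
(* Induction on the list [s] of possibly bad primes. Each correction stays in the orbit, so local
   solubility is available again at the next prime. *)
have key (s : seq nat) f : SL2_orbit f0 f ->
    (forall q (q_pr : prime q), q \notin s -> cubic_over (padic_int q_pr) f) ->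
  exists2 f', SL2_orbit f0 f' &
    forall q (q_pr : prime q), cubic_over (padic_int q_pr) f'.
  elim: s f => [|p s IHs] f Of fint.
    by exists f => // q q_pr; exact: fint.
  have [p_pr|p_npr] := boolP (prime p); last first.
    apply: (IHs f) => // q q_pr qs; apply: fint; rewrite inE negb_or qs andbT.
    by apply: contraNneq p_npr => <-.
  have [_ /(_ p p_pr) fsol] := O_soluble _ Of.
  have [g gdet [gp gq]] := exists_padic_integral k_neq0 (Odisc _ Of) fsol.
  apply: (IHs (cubic_act g f)); first exact: Oact.
  move=> q q_pr qs; have [qp|qp] := eqVneq q p.
    (* [padic_int] takes the primality proof as an argument, so the two proofs must be
       identified. *)
    by subst q; rewrite (bool_irrelevance q_pr p_pr).
  by apply: gq => //; apply: fint; rewrite inE negb_or qp.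
have Of0 : SL2_orbit f0 f0.
  by exists 1%:M; rewrite ?cubic_act1//= /SL2 /= det1.
have [s f0s] := cubic_over_padic_ae f0.
have [f Of fint] := key s f0 Of0 f0s.
have FE : cubic_map (fun n : int => n%:~R) (cubic_map numq f) = f.
  case: f {Of} fint => a b c d fint.
  by congr Cubic; apply: rat_intP => q q_pr; have [] := fint q q_pr.
exists (cubic_map numq f); split; last by rewrite FE.
apply: (@intr_inj rat); rewrite intz -(Odisc _ Of) -(congr1 (@disc _) FE).
exact: disc_map.
Qed.
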